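(* Let $R$ be an associative unital ring with invariant basis number (IBN), let $n$ be a positive integer, let $G$ be a group with identity element $e$, and suppose that $S:=M_n(R)$ is equipped with a very good $G$-grading. Let $V=R^n$ be the free left $R$-module with basis $v_1,\ldots,v_n$, graded by $V_g:=\sum_{i:\,\deg(e_{i,1})=g}Rv_i$ for $g\in G$, and let $\operatorname{Supp}(V):=\{g\in G\mid V_g\neq 0\}$. The following assertions are equivalent: (i) $S$ is an epsilon-crossed product; (ii) $\operatorname{rank}(V_g)=\operatorname{rank}(V_e)$ for every $g\in\operatorname{Supp}(V)$; (iii) $n^2=|\operatorname{Supp}(V)|\cdot\operatorname{rank}(S_e)$.
   Context: $M_n(R)$ is the ring of all $n\times n$ matrices with entries in $R$; $e_{i,j}$ denotes the matrix with $1$ in position $(i,j)$ and zeros elsewhere. IBN means that $R^k\cong R^l$ as left $R$-modules implies $k=l$ (in particular $R\neq 0$); $\operatorname{rank}$ denotes the rank of a finitely generated free left $R$-module. A $G$-grading on a ring $S$ is a family of additive subgroups $S_g$ ($g\in G$) with $S=\bigoplus_{g\in G}S_g$ as additive groups and $S_gS_h\subseteq S_{gh}$ for all $g,h\in G$, where $S_gS_h$ denotes the set of all finite sums of products $st$ with $s\in S_g$, $t\in S_h$. For a nonzero $s\in S_g$ write $\deg(s):=g$. A $G$-grading on $S=M_n(R)$ is very good if for all $i,j\in\{1,\ldots,n\}$ there is $g\in G$ with $Re_{i,j}\subseteq S_g$; in this case each $S_g$ is the free left $R$-module with basis the $e_{i,j}$ of degree $g$. A $G$-graded ring $S$ is epsilon-strongly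 $G$-graded if for every $g\in G$ there is some $\epsilon_g\in S_gS_{g^{-1}}$ such that $\epsilon_g s=s\epsilon_{g^{-1}}=s$ for every $s\in S_g$; the elements $\epsilon_g$ are then uniquely determined. An epsilon-strongly $G$-graded ring $S$ is an epsilon-crossed product if for every $g\in G$ there are $s_g\in S_g$ and $t_{g^{-1}}\in S_{g^{-1}}$ such that $s_gt_{g^{-1}}=\epsilon_g$ and $t_{g^{-1}}s_g=\epsilon_{g^{-1}}$. *)

(* Defs.v *)
From HB Require Import structures.
From mathcomp Require Import all_boot all_order all_algebra finmap.
From mathcomp Require Import boolp classical_sets cardinality.

Set Implicit Arguments.
Unset Strict Implicit.
Unset Printing Implicit Defensive.

Import GRing.Theory.
Local Open Scope classical_set_scope.
Local Open Scope ring_scope.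

Definition IBN (R : pzRingType) : Prop :=
  forall k l : nat,
    (exists f : {linear 'rV[R]_k -> 'rV[R]_l}, bijective f) -> k = l.

Section Rank.
Variables (R : pzRingType) (V : lmodType R).

Definition is_basis (U : set V) (k : nat) (b : 'I_k -> V) : Prop :=
  U = [set v | exists c : 'I_k -> R, v = \sum_i c i *: b i] /\
  (forall c : 'I_k -> R, \sum_i c i *: b i = 0 -> forall i, c i = 0).

(* The common size of the finite bases of [U], which exists and is unique when
   [U] is a finitely generated free submodule and [R] has IBN; 0 if [U] has no
   finite basis. *)
Definition rank (U : set V) : nat :=
  xget 0%N [set k | exists b : 'I_k -> V, is_basis U b].

End Rank.

Section Gradings.
Variables (G : groupType) (S : pzRingType).

Definition additive_subgroup (A : set S) : Prop :=
  A 0 /\ (forall x y, A x -> A y -> A (x - y)).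

Definition prod_set (A B : set S) : set S :=
  [set x | exists (m : nat) (a b : 'I_m -> S),
     [/\ forall i, A (a i), forall i, B (b i) & x = \sum_i a i * b i]].

Definition internal_direct_sum (S_ : G -> set S) : Prop :=
  (forall x, exists (gs : seq G) (x_ : G -> S),
     (forall g, S_ g (x_ g)) /\ x = \sum_(g <- gs) x_ g) /\
  (forall (gs : seq G) (x_ : G -> S), uniq gs ->
     (forall g, S_ g (x_ g)) -> \sum_(g <- gs) x_ g = 0 ->
     forall g, g \in gs -> x_ g = 0).

Definition is_grading (S_ : G -> set S) : Prop :=
  [/\ forall g, additive_subgroup (S_ g),
      internal_direct_sum S_ &
      forall g h, prod_set (S_ g) (S_ h) `<=` S_ (g * h)%g].

(* [deg s = g]; functional in [g] when [S_] is a grading. *)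
Definition has_deg (S_ : G -> set S) (s : S) (g : G) : Prop :=
  s <> 0 /\ S_ g s.

Definition is_epsilon (S_ : G -> set S) (eps : G -> S) : Prop :=
  forall g, prod_set (S_ g) (S_ g^-1%g) (eps g) /\
    (forall s, S_ g s -> eps g * s = s /\ s * eps g^-1%g = s).

Definition epsilon_strongly_graded (S_ : G -> set S) : Prop :=
  is_grading S_ /\ exists eps, is_epsilon S_ eps.

(* The family [eps] is unique, so quantifying over it existentially or
   universally makes no difference. *)
Definition epsilon_crossed_product (S_ : G -> set S) : Prop :=
  epsilon_strongly_graded S_ /\
  exists2 eps, is_epsilon S_ eps &
    forall g, exists s t, [/\ S_ g s, S_ g^-1%g t,
                              s * t = eps g & t * s = eps g^-1%g].

End Gradings.

Section MatrixGradings.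
Variables (R : pzRingType) (n : nat) (n_gt0 : (0 < n)%N) (G : groupType).
Variable S_ : G -> set 'M[R]_n.

Definition very_good : Prop :=
  forall i j : 'I_n, exists g : G,
    forall r : R, S_ g (r *: delta_mx i j).

(* [Ordinal n_gt0] is the index written 1 when counting from 1. *)
Definition Vcomp (g : G) : set 'rV[R]_n :=
  [set v | exists c : 'I_n -> R,
     v = \sum_(i < n | `[< has_deg S_ (delta_mx i (Ordinal n_gt0)) g >])
           c i *: delta_mx 0 i].

Definition SuppV : set G := [set g | Vcomp g <> [set 0]].

End MatrixGradings.

(* Main.v *)
(** Writing [d i] for the degree of [e_(i,1)], the matrix unit [e_(i,j)] has
    degree [d i * (d j)^-1]; so [Supp V] is the image of [d], [rank V_g] is the
    size [m_g] of the fibre of [d] over [g], and [rank S_e] is the sum of the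
    [m_g ^ 2].  Since the [m_g] add up to [n], (iii) is the equality case of
    Cauchy-Schwarz, that is, (ii).  If [s t = epsilon_g] and
    [t s = epsilon_(g^-1)], then restricting [s] and [t] to the fibres over [g]
    and [e] gives mutually inverse rectangular matrices, whence [m_g = m_e] by
    IBN.  Conversely, when all fibres have the same size, matching them in order
    gives 0-1 matrices [s] and [t] witnessing the epsilon-crossed product. *)

Require Import Defs.
From HB Require Import structures.
From mathcomp Require Import all_boot all_order all_algebra finmap.
From mathcomp Require Import boolp classical_sets cardinality.

Set Implicit Arguments.
Unset Strict Implicit.
Unset Printing Implicit Defensive.

Local Open Scope classical_set_scope.
Local Open Scope ring_scope.

Import GRing.Theory.

(** * Invariant basis number and ranks of free modules *)

Lemma IBN_oner_neq0 (R : pzRingType) : IBN R -> (1 : R) != 0.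
Proof.
move=> R_IBN; apply/eqP => R10.
have R0 (x : R) : x = 0 by rewrite -[x]mul1r R10 mul0r.
have // : 0%N = 1%N.
apply: (R_IBN 0%N 1%N); exists (mulmxr 0); exists (fun=> 0) => v.
  by apply/rowP => -[].
by apply/rowP => i; exact: etrans (R0 _) (esym (R0 _)).
Qed.

Lemma IBN_mx (R : pzRingType) k l (M : 'M[R]_(k, l)) (N : 'M[R]_(l, k)) :
  IBN R -> M *m N = 1%:M -> N *m M = 1%:M -> k = l.
Proof.
move=> R_IBN MN NM; apply: R_IBN.
exists (mulmxr M); exists (mulmxr N) => v /=.
  by rewrite -mulmxA MN mulmx1.
by rewrite -mulmxA NM mulmx1.
Qed.

Section RankTheory.
Variables (R : pzRingType) (V : lmodType R).
Implicit Types U : set V.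

Lemma is_basis_mem U k (b : 'I_k -> V) i : is_basis U b -> U (b i).
Proof.
move=> [-> _]; exists (fun j => (j == i)%:R).
rewrite (bigD1 i) //= eqxx scale1r big1 ?addr0 // => j /negPf->.
by rewrite scale0r.
Qed.

Lemma is_basis_change U k l (b : 'I_k -> V) (b' : 'I_l -> V) :
  is_basis U b -> is_basis U b' ->
  exists M : 'M[R]_(k, l), forall i, b i = \sum_j M i j *: b' j.
Proof.
move=> Ub Ub'.
have /choice[c cP] i : exists c : 'I_l -> R, b i = \sum_j c j *: b' j.
  by have := is_basis_mem i Ub; case: Ub' => -> _.
exists (\matrix_(i, j) c i j) => i; rewrite cP.
by apply: eq_bigr => j _; rewrite mxE.
Qed.

(** Substituting one change of basis into the other writes each [b i] in terms of [b] itself;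
    freeness lets the coefficients be compared. *)
Lemma is_basis_mulmx1 U k l (b : 'I_k -> V) (b' : 'I_l -> V)
    (M : 'M[R]_(k, l)) (N : 'M[R]_(l, k)) :
  is_basis U b -> (forall i, b i = \sum_j M i j *: b' j) ->
  (forall j, b' j = \sum_i N j i *: b i) -> M *m N = 1%:M.
Proof.
move=> [_ free_b] bM b'N; apply/matrixP => i i'.
apply/eqP; rewrite -subr_eq0; apply/eqP; move: i'; apply: free_b.
under eq_bigr do rewrite scalerBl.
rewrite sumrB [X in _ - X](bigD1 i) //= mxE eqxx scale1r.
rewrite [X in b i + X]big1 ?addr0;
  last by move=> j; rewrite mxE eq_sym => /negPf->; exact: scale0r.
apply/eqP; rewrite subr_eq0; apply/eqP; rewrite [RHS]bM.
under eq_bigr do rewrite mxE scaler_suml.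
rewrite exchange_big; apply: eq_bigr => j _ /=.
by rewrite b'N scaler_sumr; apply: eq_bigr => i' _; rewrite scalerA.
Qed.

Lemma is_basis_card U k l (b : 'I_k -> V) (b' : 'I_l -> V) :
  IBN R -> is_basis U b -> is_basis U b' -> k = l.
Proof.
move=> R_IBN Ub Ub'.
have [M bM] := is_basis_change Ub Ub'; have [N b'N] := is_basis_change Ub' Ub.
exact: IBN_mx R_IBN (is_basis_mulmx1 Ub bM b'N) (is_basis_mulmx1 Ub' b'N bM).
Qed.

(** Enumerating [P] gives a basis with [#|P|] elements, and IBN makes this the only size that [xget]
    can choose. *)
Lemma rank_span (I : finType) (P : pred I) (e : I -> V) :
  IBN R -> (forall c : I -> R, \sum_i c i *: e i = 0 -> forall i, c i = 0) ->
  rank [set v | exists c : I -> R, v = \sum_(i | P i) c i *: e i] = #|P|.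
Proof.
move=> R_IBN free_e.
have Pb : is_basis [set v | exists c : I -> R, v = \sum_(i | P i) c i *: e i]
    (fun k : 'I_#|P| => e (enum_val k)).
  split.
    apply/seteqP; split => v /= [c ->].
      exists (fun k => c (enum_val k)).
      by rewrite -(big_enum_val (A := P) (fun i => c i *: e i)).
    case: (pickP P) => [i0 Pi0 | P0].
      exists (fun i => c (enum_rank_in Pi0 i)).
      rewrite (big_enum_val (A := P) (fun i => c (enum_rank_in Pi0 i) *: e i)).
      by apply: eq_bigr => k _; rewrite enum_valK_in.
    exists (fun=> 0); rewrite [RHS]big_pred0 // big1 // => k _.
    by have := enum_valP k; rewrite unfold_in P0.
  move=> c c0 k.
  (* Extending the coefficients by 0 outside [P] reduces the claim to freeness of the whole family
     [e]. *)
  pose c' i := if [pick k' | enum_val k' == i] is Some k' then c k' else 0.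
  have c'E k' : c' (enum_val k') = c k'.
    rewrite /c'; case: pickP => [k'' /eqP/enum_val_inj -> // | /(_ k')].
    by rewrite eqxx.
  rewrite -c'E; apply: free_e; rewrite (bigID P) /= [X in _ + X]big1 ?addr0.
    rewrite (big_enum_val (A := P) (fun i => c' i *: e i)) -[RHS]c0.
    by apply: eq_bigr => k' _; rewrite c'E.
  move=> i nPi; rewrite /c'; case: pickP => [k' /eqP ik | _];
    last exact: scale0r.
  by move: nPi; rewrite -ik; have := enum_valP k'; rewrite unfold_in => ->.
apply: xget_unique; first by exists (fun k => e (enum_val k)).
by move=> l [b' Pb']; apply: is_basis_card Pb' Pb.
Qed.

End RankTheory.

(** With [m t] the size of the fibre over [t], sum the inequality
    [2 * (m t * m t') <= m t ^ 2 + m t' ^ 2] over all pairs. The totals are twice the two sides of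
    the equation, and equality of the totals forces equality for each pair. *)
Lemma equal_fibers_card (I T : finType) (p : I -> T) :
  (#|I| ^ 2 = #|T| * #|[pred ij : I * I | p ij.1 == p ij.2]|)%N <->
  (forall t t', #|[pred i | p i == t]| = #|[pred i | p i == t']|).
Proof.
pose m t := #|[pred i | p i == t]|.
have -> : #|I| = (\sum_t m t)%N.
  rewrite -sum1_card (partition_big p xpredT) //=.
  by apply: eq_bigr => t _; rewrite sum1_card.
have -> : #|[pred ij : I * I | p ij.1 == p ij.2]| = (\sum_t m t * m t)%N.
  rewrite -sum1_card (partition_big (fun ij => p ij.1) xpredT) //=.
  apply: eq_bigr => t _; rewrite -cardX sum1_card.
  apply: eq_card => -[i j]; rewrite !inE /=.
  rewrite unfold_in /= inE /=; case: (p i =P t) => [<- | _];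
    by rewrite ?andbT ?andbF //= eq_sym.
have cauchy := leqif_sum (fun (tt : T * T) (_ : xpredT tt) =>
   nat_Cauchy (m tt.1) (m tt.2)).
move: cauchy.
have -> : (\sum_(tt : T * T) 2 * (m tt.1 * m tt.2) = 2 * (\sum_t m t) ^ 2)%N.
  rewrite -big_distrr /= expnS expn1 big_distrlr /=.
  by rewrite pair_big.
have -> : (\sum_(tt : T * T) (m tt.1 ^ 2 + m tt.2 ^ 2)
           = 2 * (#|T| * \sum_t m t * m t))%N.
  rewrite -(pair_big xpredT xpredT (fun t t' => m t ^ 2 + m t' ^ 2)%N) /=.
  under eq_bigr do rewrite big_split sum_nat_const /=.
  rewrite big_split -big_distrr sum_nat_const /= addnn mul2n.
  by under eq_bigr do rewrite expnS expn1.
move=> [_ cauchy]; split.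
  move=> /(congr1 (muln 2)) /eqP; rewrite cauchy => /forallP mE t t'.
  by apply/eqP; apply: (mE (t, t')).
move=> mE; apply/eqP; rewrite -(eqn_pmul2l (isT : 0 < 2)%N) cauchy.
by apply/forallP => -[t t']; apply/eqP; exact: mE.
Qed.

(** * Homogeneous elements of graded rings *)

Section Gradings.
Variables (G : groupType) (S : pzRingType) (S_ : G -> set S).
Hypothesis S_graded : is_grading S_.

Lemma graded0 g : S_ g 0.
Proof. by case: S_graded => + _ _ => /(_ g)[]. Qed.

Lemma gradedB g x y : S_ g x -> S_ g y -> S_ g (x - y).
Proof. by case: S_graded => + _ _ => /(_ g)[_]; apply. Qed.

Lemma graded_sum g (I : Type) (r : seq I) (P : pred I) (F : I -> S) :
  (forall i, P i -> S_ g (F i)) -> S_ g (\sum_(i <- r | P i) F i).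
Proof.
move=> SF; apply: big_ind SF; first exact: graded0.
move=> x y Sx Sy; rewrite -[y]opprK; apply: gradedB => //.
by rewrite -sub0r; apply: gradedB => //; exact: graded0.
Qed.

Lemma gradedM g h x y : S_ g x -> S_ h y -> S_ (g * h)%g (x * y).
Proof.
case: S_graded => _ _ + Sx Sy; apply.
by exists 1%N, (fun=> x), (fun=> y); rewrite big_ord1.
Qed.

Lemma graded_deg_uniq g h x : x != 0 -> S_ g x -> S_ h x -> g = h.
Proof.
case: S_graded => _ [_ S_free] _ x0 Sgx Shx; apply/eqP/negPn/negP => gh.
move/eqP: x0; apply.
(* If [g] and [h] differed, [x] in degree [g] and [- x] in degree [h] would be a nontrivial
   decomposition of 0. *)
pose x_ k := if k == g then x else if k == h then - x else 0.
have -> : x = x_ g by rewrite /x_ eqxx.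
apply: (S_free [:: g; h]); rewrite ?mem_head //=; first by rewrite inE gh.
  move=> k; rewrite /x_; case: eqP => [-> // | _].
  case: eqP => [-> | _]; last exact: graded0.
  by rewrite -sub0r; apply: gradedB => //; exact: graded0.
by rewrite !big_cons big_nil addr0 /x_ eqxx eq_sym (negPf gh) eqxx subrr.
Qed.

End Gradings.

(** * Degrees of matrix units in a very good grading *)

Section VeryGood.
Variables (R : pzRingType) (n : nat) (n_gt0 : (0 < n)%N) (G : groupType).
Variable S_ : G -> set 'M[R]_n.
Hypotheses (R1 : (1 : R) != 0) (S_graded : is_grading S_).
Hypothesis S_very_good : very_good S_.

Lemma delta_mx_neq0 m p (i : 'I_m) (j : 'I_p) :
  (delta_mx i j : 'M[R]_(m, p)) != 0.
Proof.
by apply/eqP => /matrixP/(_ i j)/eqP; rewrite !mxE !eqxx (negPf R1).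
Qed.

(* The homogeneous components of [A] are obtained by sorting the summands
   [A i j *: delta_mx i j] by degree; if [A] is itself homogeneous, only one
   of them survives. *)
Lemma very_good_comp (D : 'I_n * 'I_n -> G) :
  (forall ij r, S_ (D ij) (r *: delta_mx ij.1 ij.2)) ->
  forall g A, S_ g A <-> forall i j, D (i, j) != g -> A i j = 0.
Proof.
move=> SD g A.
pose x h := \sum_(ij | D ij == h) A ij.1 ij.2 *: delta_mx ij.1 ij.2 : 'M[R]_n.
have Sx h : S_ h (x h).
  by apply: graded_sum => // ij /eqP <-; exact: SD.
have xE h i j : x h i j = if D (i, j) == h then A i j else 0.
  rewrite /x summxE big_mkcond /= (bigD1 (i, j)) //= big1 ?addr0.
    by case: ifP => //; rewrite !mxE !eqxx mulr1.
  move=> [i' j']; rewrite xpair_eqE /= => ij.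
  case: ifP => // _.
  by rewrite !mxE [i == _]eq_sym [j == _]eq_sym (negPf ij) mulr0.
split=> [SA i j Dij | A0]; last first.
  suff -> : A = x g by [].
  by apply/matrixP => i j; rewrite xE; case: eqP => // /eqP; exact: A0.
suff xA : x g - A = 0.
  by have /eqP := xA; rewrite subr_eq0 => /eqP <-; rewrite xE (negPf Dij).
case: S_graded => _ [_ S_free] _.
pose y h := if h == g then x h - A else x h.
(* All degrees of matrix units are listed so that the [x h] add up to [A]; [g] is added because it
   need not be one of them. *)
pose gs := undup (g :: [seq D ij | ij : 'I_n * 'I_n]).
have g_gs : g \in gs by rewrite mem_undup mem_head.
have -> : x g - A = y g by rewrite /y eqxx.
apply: (S_free gs) => //; first exact: undup_uniq.
  by move=> h; rewrite /y; case: eqP => // ->; apply: gradedB.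
rewrite (bigD1_seq g) ?undup_uniq //= {1}/y eqxx addrAC.
have -> : \sum_(h <- gs | h != g) y h = \sum_(h <- gs | h != g) x h.
  by apply: eq_bigr => h /negPf hg; rewrite /y hg.
rewrite -(bigD1_seq g) ?undup_uniq //=; apply/eqP; rewrite subr_eq0; apply/eqP.
apply/matrixP => k l; rewrite summxE (bigD1_seq (D (k, l))) ?undup_uniq //=.
  rewrite xE eqxx big1 ?addr0 // => h; rewrite xE eq_sym.
  by move=> /negPf ->.
by rewrite mem_undup inE orbC map_f ?mem_enum.
Qed.

(** The product of the units at [(i, j)] and [(j, k)] is the nonzero unit at [(i, k)], so [D] is
    multiplicative along such pairs and is determined by its column [o]. *)
Lemma very_good_deg : exists2 d : 'I_n -> G, d (Ordinal n_gt0) = 1%g &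
  forall g A, S_ g A <-> forall i j, d i != (g * d j)%g -> A i j = 0.
Proof.
have /choice[D SD] : forall ij : 'I_n * 'I_n, exists g,
    forall r, S_ g (r *: delta_mx ij.1 ij.2).
  by move=> [i j]; exact: S_very_good.
pose o := Ordinal n_gt0.
have DM i j k : (D (i, j) * D (j, k))%g = D (i, k).
  apply: (graded_deg_uniq S_graded (delta_mx_neq0 i k)).
    rewrite -(@mul_delta_mx R n n n j i k) mulmxE; apply: gradedM => //.
      by have := SD (i, j) 1; rewrite scale1r.
    by have := SD (j, k) 1; rewrite scale1r.
  by have := SD (i, k) 1; rewrite scale1r.
exists (fun i => D (i, o)) => [|g A].
  by apply: (mulIg (D (o, o))); rewrite DM mul1g.
rewrite (very_good_comp SD).
have DE i j : (D (i, j) == g) = (D (i, o) == g * D (j, o))%g.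
  by rewrite -(DM i j o) (inj_eq (@mulIg _ _)).
by split=> A0 i j; have := A0 i j; rewrite DE.
Qed.

End VeryGood.

(** * Support and ranks in terms of the fibres of [d] *)

Section Degrees.
Variables (R : pzRingType) (n : nat) (n_gt0 : (0 < n)%N) (G : groupType).
Variable S_ : G -> set 'M[R]_n.
Hypotheses (R_IBN : IBN R) (S_graded : is_grading S_).
Variable d : 'I_n -> G.
Hypothesis d1 : d (Ordinal n_gt0) = 1%g.
Hypothesis SE :
  forall g A, S_ g A <-> forall i j, d i != (g * d j)%g -> A i j = 0.

Lemma has_deg_delta i j g :
  has_deg S_ (delta_mx i j) g <-> d i = (g * d j)%g.
Proof.
rewrite /has_deg SE; split=> [[_ A0] | dij].
  apply/eqP/negPn/negP => /A0/eqP.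
  by rewrite !mxE !eqxx (negPf (IBN_oner_neq0 R_IBN)).
split=> [|k l].
  by apply/eqP; exact: (delta_mx_neq0 (IBN_oner_neq0 R_IBN)).
rewrite mxE; case: (k =P i) => [->|//]; case: (l =P j) => [->|//].
by rewrite dij eqxx.
Qed.

Lemma VcompE g : Vcomp n_gt0 S_ g =
  [set v | exists c : 'I_n -> R, v = \sum_(i | d i == g) c i *: delta_mx 0 i].
Proof.
have dE i : `[< has_deg S_ (delta_mx i (Ordinal n_gt0)) g >] = (d i == g).
  by apply/asboolP/eqP; rewrite has_deg_delta d1 mulg1.
by apply/seteqP; split=> v [c ->]; exists c; apply: eq_bigl => i; rewrite dE.
Qed.

Lemma delta_row_free (c : 'I_n -> R) :
  \sum_i c i *: (delta_mx 0 i : 'rV[R]_n) = 0 -> forall i, c i = 0.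
Proof.
move=> c0 i; have := congr1 (fun v : 'rV[R]_n => v 0 i) c0.
rewrite summxE (bigD1 i) //= !mxE !eqxx mulr1 big1 ?addr0 // => j ji.
by rewrite !mxE eq_sym (negPf ji) andbF mulr0.
Qed.

Lemma rank_Vcomp g : rank (Vcomp n_gt0 S_ g) = #|[pred i | d i == g]|.
Proof. by rewrite VcompE; apply: (rank_span _ R_IBN delta_row_free). Qed.

Lemma SuppVE g : SuppV n_gt0 S_ g <-> exists i, d i = g.
Proof.
rewrite /SuppV /= VcompE; split=> [nz | [i di] V0].
  apply: contrapT => nd; apply: nz; apply/seteqP; split=> v /=.
    move=> [c ->]; rewrite big_pred0 // => i; apply/negP => /eqP di.
    by apply: nd; exists i.
  move=> ->; exists (fun=> 0); rewrite big1 // => i _; exact: scale0r.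
have : [set 0] (delta_mx 0 i : 'rV[R]_n).
  rewrite -V0 /=; exists (fun j => (j == i)%:R).
  rewrite (bigD1 i) ?di //= eqxx scale1r big1 ?addr0 // => j /andP[_ /negPf->].
  exact: scale0r.
by move=> /eqP; rewrite (negPf (delta_mx_neq0 (IBN_oner_neq0 R_IBN) _ _)).
Qed.

Lemma delta_mx_free (c : 'I_n * 'I_n -> R) :
  \sum_ij c ij *: (delta_mx ij.1 ij.2 : 'M[R]_n) = 0 -> forall ij, c ij = 0.
Proof.
move=> c0 [i j]; have := congr1 (fun A : 'M[R]_n => A i j) c0.
rewrite summxE (bigD1 (i, j)) //= !mxE !eqxx mulr1 big1 ?addr0 // => -[k l].
by rewrite !mxE eq_sym xpair_eqE => /negPf->; rewrite mulr0.
Qed.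

(** The units of degree 1 correspond to pairs of indices in a common fibre, the count that enters
    [equal_fibers_card]. *)
Lemma rank_comp1 : rank (S_ 1%g) = #|[pred ij | d ij.1 == d ij.2]|.
Proof.
rewrite -(rank_span _ R_IBN delta_mx_free); congr rank.
apply/seteqP; split=> A; rewrite SE /=.
  move=> A0; exists (fun ij => A ij.1 ij.2).
  rewrite [LHS]matrix_sum_delta pair_big /=.
  rewrite [LHS](bigID (fun ij => d ij.1 == d ij.2)) /=.
  rewrite [X in _ + X]big1 ?addr0 // => -[i j] /= dij.
  by rewrite A0 ?mul1g // scale0r.
move=> [c ->] i j; rewrite mul1g => dij.
rewrite summxE big1 // => -[k l] /= /eqP dkl.
rewrite !mxE; case: eqP => [ik|]; last by rewrite mulr0.
case: eqP => [jl|]; last by rewrite mulr0.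
by rewrite ik jl dkl eqxx in dij.
Qed.

Lemma SuppV_card :
  (n ^ 2 = #|` fset_set (SuppV n_gt0 S_)| * rank (S_ 1%g))%N <->
  forall i j, #|[pred k | d k == d i]| = #|[pred k | d k == d j]|.
Proof.
(* [G] may be infinite, so [d] is corestricted to the finite set of its values, giving a surjection
   [p] between finite types. *)
pose F := [fset d i | i : 'I_n]%fset.
have dF i : d i \in F by apply/imfsetP; exists i.
have -> : SuppV n_gt0 S_ = [set` F].
  apply/seteqP; split=> g.
    by move=> /SuppVE[i <-]; exact: dF.
  by move=> /imfsetP[i _ ->]; apply/SuppVE; exists i.
pose p i : F := [` dF i]%fset.
have pE i j : (p i == p j) = (d i == d j) by rewrite -val_eqE.
rewrite set_fsetK rank_comp1 cardfE -{1}(card_ord n).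
have -> : #|[pred ij | d ij.1 == d ij.2]| = #|[pred ij | p ij.1 == p ij.2]|.
  by apply: eq_card => ij; rewrite [RHS]inE /= pE.
rewrite equal_fibers_card.
have fibE i : #|[pred k | d k == d i]| = #|[pred k | p k == p i]|.
  by apply: eq_card => k; rewrite [RHS]inE pE.
split=> [E i j | E t t']; first by rewrite !fibE.
have p_surj (u : F) : exists i, p i = u.
  by case: u => u uF; have /imfsetP[i _ ui] := uF; exists i; apply/val_inj.
by have [[i <-] [j <-]] := (p_surj t, p_surj t'); rewrite -!fibE.
Qed.

(* The blocks of [s] and [t] with row degree [d i] and column degree 1 (and
   conversely) are mutually inverse rectangular matrices. *)
Lemma crossed_fiber_card i : epsilon_crossed_product S_ ->
  #|[pred k | d k == d i]| = #|[pred k | d k == 1%g]|.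
Proof.
move=> [_ [eps epsP stP]].
(* Here the unit at [(l, k)] lies in [S_ g] and is fixed by left multiplication by [eps g]; column
   [k] of that product is column [l] of [eps g]. *)
have eps_id g k l j : d l = (g * d k)%g -> eps g j l = (j == l)%:R.
  move=> dlk; have [_ Slk] := (has_deg_delta l k g).2 dlk.
  have [+ _] := (epsP g).2 _ Slk; move=> /matrixP/(_ j k).
  rewrite mxE (bigD1 l) //= big1 ?addr0; last first.
    by move=> m /negPf ml; rewrite mxE ml mulr0.
  by rewrite !mxE !eqxx mulr1 andbT.
have [s [t [Ss St st ts]]] := stP (d i).
move/SE: Ss => s0; move/SE: St => t0.
pose I := [pred k | d k == d i]; pose J := [pred k | d k == 1%g].
have dI (a : 'I_#|I|) : d (enum_val a) = d i.
  by have := enum_valP a; rewrite inE => /eqP.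
have dJ (b : 'I_#|J|) : d (enum_val b) = 1%g.
  by have := enum_valP b; rewrite inE => /eqP.
apply: (@IBN_mx R _ _ (\matrix_(a < #|I|, b < #|J|) s (enum_val a) (enum_val b))
   (\matrix_(b < #|J|, a < #|I|) t (enum_val b) (enum_val a)) R_IBN).
  apply/matrixP => a a'; rewrite !mxE.
  transitivity (eps (d i) (enum_val a) (enum_val a')); last first.
    rewrite (eps_id _ (Ordinal n_gt0)) ?dI ?d1 ?mulg1 //.
    by rewrite (inj_eq enum_val_inj).
  (* In a row from [I], homogeneity of [s] kills all entries in columns outside [J], so the product
     restricts to the blocks. *)
  rewrite -st mxE (bigID (fun k => k \in J)) /= [X in _ = _ + X]big1 ?addr0.
    by rewrite [RHS]big_enum_val; apply: eq_bigr => b _; rewrite !mxE.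
  move=> k; rewrite inE => dk; rewrite s0 ?mul0r // dI.
  by apply: contra dk => /eqP dik; rewrite -(mulKg (d i) (d k)) -dik mulVg.
apply/matrixP => b b'; rewrite !mxE.
transitivity (eps (d i)^-1%g (enum_val b) (enum_val b')); last first.
  by rewrite (eps_id _ i) ?dJ ?mulVg // (inj_eq enum_val_inj).
rewrite -ts mxE (bigID (fun k => k \in I)) /= [X in _ = _ + X]big1 ?addr0.
  by rewrite [RHS]big_enum_val; apply: eq_bigr => a _; rewrite !mxE.
move=> k; rewrite inE => dk; rewrite t0 ?mul0r // dJ.
by apply: contra dk => /eqP dik; rewrite -[d k](mulVKg (d i)) -dik mulg1.
Qed.

(** * Crossed product elements from fibres of equal size *)

Definition fiber_index i := index i (enum [pred k | d k == d i]).

Lemma fiber_index_inj i j : d i = d j -> fiber_index i = fiber_index j -> i = j.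
Proof.
move=> dij; rewrite /fiber_index dij.
by apply: (index_inj i); rewrite mem_enum inE ?dij.
Qed.

Lemma fiber_index_surj i j :
  #|[pred k | d k == d i]| = #|[pred k | d k == d j]| ->
  exists2 k, d k = d j & fiber_index k = fiber_index i.
Proof.
move=> cij; set s := enum [pred k | d k == d j].
(* Equal sizes make the position of [i] valid in the other fibre, so the default of [nth] is never
   reached. *)
have ltis : (fiber_index i < size s)%N.
  by rewrite -cardE -cij cardE index_mem mem_enum inE.
have dk : d (nth i s (fiber_index i)) = d j.
  by have := mem_nth i ltis; rewrite mem_enum inE => /eqP.
exists (nth i s (fiber_index i)) => //.
by rewrite {1}/fiber_index dk index_uniq ?enum_uniq.
Qed.

(** This is the diagonal idempotent selecting the rows that contain a unit of degree [g], the only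
    rows where elements of [S_ g] can be nonzero. *)
Definition epsilon_mx g : 'M[R]_n :=
  diag_mx (\row_i ([exists k, d i == (g * d k)%g])%:R).

(* When all fibres of [d] have the same size, [match_mx g] matches the
   elements of the fibre over [g * h] with those of the fibre over [h] in order. *)
Definition match_mx g : 'M[R]_n :=
  \matrix_(i, j) ((d i == (g * d j)%g) && (fiber_index i == fiber_index j))%:R.

Lemma match_mxE g i j :
  match_mx g i j =
  ((d i == (g * d j)%g) && (fiber_index i == fiber_index j))%:R.
Proof. exact: mxE. Qed.

Lemma match_mx_mem g : S_ g (match_mx g).
Proof. by apply/SE => i j /negPf dij; rewrite match_mxE dij. Qed.

(** If row [i] contains a unit of degree [g], exactly one [j] matches [i], and matching back from
    [j] returns only to [i]. Otherwise row [i] of [match_mx g] is zero. *)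
Lemma match_mx_mul g :
  (forall i j, #|[pred k | d k == d i]| = #|[pred k | d k == d j]|) ->
  match_mx g * match_mx g^-1%g = epsilon_mx g.
Proof.
move=> fibE; apply/matrixP => i l; rewrite -mulmxE !mxE.
have dV j : (d j == g^-1 * d l)%g = (d l == (g * d j)%g).
  by rewrite -(inj_eq (@mulgI _ g)) mulVKg eq_sym.
case: existsP => [[k /eqP dik] | nd]; last first.
  rewrite mul0rn big1 // => j _; rewrite !match_mxE.
  case: eqP => [dij|]; last by rewrite mul0r.
  by case: nd; exists j; rewrite dij.
have [j djk ji] := fiber_index_surj (fibE i k).
rewrite (bigD1 j) //= big1 ?addr0.
  rewrite !match_mxE djk dV -dik ji !eqxx mul1r.
  case: (i =P l) => [<- | il]; first by rewrite !eqxx.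
  rewrite mulr0n; case: eqP => // dli.
  by case: eqP => // /(fiber_index_inj (esym dli)).
move=> m mj; rewrite !match_mxE.
case: eqP => [dim|]; last by rewrite mul0r.
case: eqP => [im|]; last by rewrite mul0r.
case/eqP: mj; apply: fiber_index_inj; last by rewrite -im.
by apply: (@mulgI _ g); rewrite djk -dim -dik.
Qed.

Lemma fiber_card_crossed :
  (forall i j, #|[pred k | d k == d i]| = #|[pred k | d k == d j]|) ->
  epsilon_crossed_product S_.
Proof.
move=> fibE.
have epsP : is_epsilon S_ epsilon_mx.
  move=> g; split.
    exists 1%N, (fun=> match_mx g), (fun=> match_mx g^-1%g).
    by split=> [_|_|]; rewrite ?big_ord1 ?match_mx_mul //; exact: match_mx_mem.
  move=> s /SE s0; rewrite -!mulmxE mul_diag_mx mul_mx_diag.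
  split; apply/matrixP => i j; rewrite !mxE.
    case: existsP => [_|nd]; first by rewrite mul1r.
    by rewrite s0 ?mulr0 //; apply/negP => dij; apply: nd; exists j.
  case: existsP => [_|nd]; first by rewrite mulr1.
  rewrite s0 ?mulr0 //; apply/negP => /eqP dij; apply: nd; exists i.
  by rewrite dij mulKg.
split; first by split=> //; exists epsilon_mx.
exists epsilon_mx => // g; exists (match_mx g), (match_mx g^-1%g).
split; rewrite ?match_mx_mul //; try exact: match_mx_mem.
by rewrite -{2}[g]invgK match_mx_mul.
Qed.

End Degrees.

(* [SuppV] has at most n elements, so [fset_set] is meaningful here. *)
Theorem theorem2p13 (R : pzRingType) (R_IBN : IBN R)
    (n : nat) (n_gt0 : (0 < n)%N) (G : groupType)
    (S_ : G -> set 'M[R]_n)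
    (S_graded : is_grading S_) (S_very_good : very_good S_) :
  [<-> epsilon_crossed_product S_;
       forall g : G, SuppV n_gt0 S_ g ->
         rank (Vcomp n_gt0 S_ g) = rank (Vcomp n_gt0 S_ 1%g);
       (n ^ 2 = #|` fset_set (SuppV n_gt0 S_)| * rank (S_ 1%g))%N].
Proof.
have [d d1 SE] :=
  very_good_deg n_gt0 (IBN_oner_neq0 R_IBN) S_graded S_very_good.
tfae.
- move=> crossed g /(SuppVE R_IBN d1 SE)[i <-].
  by rewrite !(rank_Vcomp R_IBN d1 SE); exact: crossed_fiber_card crossed.
(* Both [d i] and [d j] lie in the support, so each fibre size equals the rank of the component of
   degree 1. *)
- move=> rankE; apply/(SuppV_card R_IBN d1 SE) => i j.
  rewrite -!(rank_Vcomp R_IBN d1 SE) !rankE //; apply/(SuppVE R_IBN d1 SE).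
    by exists j.
  by exists i.
- by move=> /(SuppV_card R_IBN d1 SE); exact: fiber_card_crossed.
Qed.
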